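(* Let $q$ be a prime power and $n\ge 1$ an integer. Let $\{\theta_1,\theta_2,\dots,\theta_n\}$ be any given basis of $\mathbb{F}_{q^n}$ over $\mathbb{F}_q$, and let $$L(x)=\mathrm{Tr}(\theta_1x)\omega_1+\mathrm{Tr}(\theta_2x)\omega_2+\cdots+\mathrm{Tr}(\theta_nx)\omega_n,\qquad \omega_1,\dots,\omega_n\in\mathbb{F}_{q^n}.$$ Then $L(x)$ is a permutation polynomial over $\mathbb{F}_{q^n}$ if and only if for every $u\in\mathbb{F}_{q^n}^*$, $\mathrm{Tr}(uL(x))\not\equiv 0 \pmod{x^{q^n}-x}$.
   Context: $\mathbb{F}_{q^n}$ is the finite field with $q^n$ elements and $\mathbb{F}_{q^n}^*=\mathbb{F}_{q^n}\setminus\{0\}$. $\mathrm{Tr}(x)=x+x^q+\cdots+x^{q^{n-1}}$ is the trace function from $\mathbb{F}_{q^n}$ to $\mathbb{F}_q$. A polynomial over $\mathbb{F}_{q^n}$ is a permutation polynomial over $\mathbb{F}_{q^n}$ if the induced map $\mathbb{F}_{q^n}\to\mathbb{F}_{q^n}$ is bijective. A polynomial is $\not\equiv 0\pmod{x^{q^n}-x}$ exactly when the map it induces on $\mathbb{F}_{q^n}$ is not identically zero. *)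

(* Defs.v *)
From HB Require Import structures.
From mathcomp Require Import all_boot all_order all_algebra all_field.

Set Implicit Arguments.
Unset Strict Implicit.
Unset Printing Implicit Defensive.

Import GRing.Theory.
Local Open Scope ring_scope.

(* Stated over any ring so that the same formula applies to elements of
   F_{q^n} and to polynomials over F_{q^n}; in the latter case
   trace_pow q n p is the polynomial Tr(p(x)). *)
Definition trace_pow (R : nzRingType) (q n : nat) (x : R) : R :=
  \sum_(i < n) x ^+ (q ^ i).

Definition permutation_poly (K : nzRingType) (p : {poly K}) : Prop :=
  bijective (fun x : K => p.[x]).

Definition trace_comb (K : nzRingType) (q n : nat) (theta omega : n.-tuple K) :
    {poly K} :=
  \sum_(i < n)
     trace_pow q n ((tnth theta i)%:P * 'X) * (tnth omega i)%:P.

(* Main.v *)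
(** With respect to the nondegenerate form [(x, y) |-> Tr (x y)], the map
    induced by [L] has adjoint [L' : u |-> \sum_i Tr (u omega_i) theta_i], and
    [Tr (u L(x))] vanishes identically in [x] exactly when [u] is orthogonal to
    the image of [L], that is, when [L' u = 0].  If [L] is onto, only [u = 0]
    does so.  Conversely, if only [u = 0] does so then [L'] is injective, hence
    onto by finiteness, and the kernel of [L], being orthogonal to the image of
    [L'], is trivial. *)
Require Import Defs.
From HB Require Import structures.
From mathcomp Require Import all_boot all_order all_algebra all_field.
From mathcomp Require Import abelian.

Set Implicit Arguments.
Unset Strict Implicit.
Unset Printing Implicit Defensive.

Import GRing.Theory.
Local Open Scope ring_scope.

Lemma horner_trace_pow (R : comNzRingType) (q n : nat) (p : {poly R}) (x : R) :
  (trace_pow q n p).[x] = trace_pow q n p.[x].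
Proof.
by rewrite /trace_pow horner_sum; apply: eq_bigr => i _; rewrite horner_exp.
Qed.

Lemma horner_trace_comb (R : comNzRingType) (q n : nat)
    (theta omega : n.-tuple R) (x : R) :
  (trace_comb q theta omega).[x] =
  \sum_(i < n) trace_pow q n (tnth theta i * x) * tnth omega i.
Proof.
rewrite /trace_comb horner_sum; apply: eq_bigr => i _.
by rewrite hornerM horner_trace_pow hornerM !hornerC hornerX.
Qed.

Lemma trace_pow0 (R : nzRingType) (q n : nat) :
  (0 < q)%N -> trace_pow q n (0 : R) = 0.
Proof.
by move=> q0; apply: big1 => i _; rewrite expr0n expn_eq0 -leqn0 leqNgt q0.
Qed.

Lemma size_trace_powX (R : nzRingType) (q n : nat) : (1 < q)%N ->
  (size (trace_pow q n.+1 ('X : {poly R})) <= (q ^ n).+1)%N.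
Proof.
move=> q1; apply: leq_trans (size_sum _ _ _) _; apply/bigmax_leqP => i _.
by rewrite size_polyXn ltnS leq_exp2l // -ltnS.
Qed.

(** The coefficient of degree 1 is 1: since [1 < q], only the summand [i = 0] contributes to it. *)
Lemma trace_powX_neq0 (R : nzRingType) (q n : nat) : (1 < q)%N ->
  trace_pow q n.+1 ('X : {poly R}) != 0.
Proof.
move=> q1; apply/eqP => /(congr1 (fun p : {poly R} => p`_1)).
rewrite coef0 coef_sum big_ord_recl expr1 coefX big1 => [|i _].
  by rewrite addr0; apply/eqP/oner_neq0.
by rewrite coefXn -[X in X == _](expn0 q) eqn_exp2l.
Qed.

(** [A] has the characteristic [p] of [F], and the additive group of [F] is an elementary abelian
    [p]-group. This is what makes [q]-th powers additive on extensions of [F]. *)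
Lemma pchar_nat_card (F : finFieldType) (A : lalgType F) : [pchar A].-nat #|F|.
Proof.
have [p _ pF] := finPcharP F; rewrite (eq_pnat _ (pchar_lalg A)).
rewrite (eq_pnat _ (pcharf_eq pF)) -cardsT.
exact/abelem_pgroup/fin_ring_pchar_abelem.
Qed.

Lemma expr_card_expD (F : finFieldType) (K : fieldExtType F) (k : nat)
    (x y : K) :
  (x + y) ^+ (#|F| ^ k) = x ^+ (#|F| ^ k) + y ^+ (#|F| ^ k).
Proof. by apply: exprDn_pchar; rewrite pnatX pchar_nat_card. Qed.

Lemma expr_card_full (F : finFieldType) (K : fieldExtType F) (x : K) :
  x ^+ (#|F| ^ \dim {:K}) = x.
Proof. by apply/eqP; rewrite -Fermat's_little_theorem memvf. Qed.

Lemma expr_card_scalar (F : finFieldType) (K : fieldExtType F) (k : nat)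
    (x : K) :
  x \in 1%VS -> x ^+ (#|F| ^ k) = x.
Proof.
rewrite Fermat's_little_theorem dimv1 expn1 => /eqP xq.
by elim: k => [|k IHk]; rewrite ?expr1 // expnS exprM xq.
Qed.

Lemma dvdp_finite_field (F : finFieldType) (K : fieldExtType F)
    (p : {poly K}) :
  reflect (forall x, p.[x] = 0) ('X^(#|F| ^ \dim {:K}) - 'X %| p).
Proof.
apply: (iffP idP) => [/dvdpP [r ->] x | p0].
  by rewrite !hornerE expr_card_full subrr mulr0.
(* [finvect_type K] is [K] seen as a finite field; its order is the exponent, so the divisor becomes
   the product of all ['X - a] with [a] in [K]. *)
rewrite -(card_vspace (T := finvect_type K)) card_vspacef.
rewrite (finField_genPoly (finvect_type K)).
apply: uniq_roots_dvdp; first by apply/allP => x _; apply/eqP/p0.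
by rewrite uniq_rootsE; exact: (@index_enum_uniq (finvect_type K)).
Qed.

Section Trace.
Variables (F : finFieldType) (K : fieldExtType F).
Implicit Types (u x y : K).
Local Notation n := (\dim {:K}).
Local Notation Tr := (trace_pow #|F| n).

Lemma trace_powD x y : Tr (x + y) = Tr x + Tr y.
Proof.
by rewrite -big_split; apply: eq_bigr => i _; rewrite expr_card_expD.
Qed.

Lemma trace_pow_sum (I : finType) (f : I -> K) :
  Tr (\sum_i f i) = \sum_i Tr (f i).
Proof.
apply: (big_morph Tr trace_powD); apply: trace_pow0.
exact: ltnW (finNzRing_gt1 F).
Qed.

Lemma trace_pow_scalarM x y : x \in 1%VS -> Tr (x * y) = x * Tr y.
Proof.
move=> x1; rewrite /trace_pow mulr_sumr; apply: eq_bigr => i _.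
by rewrite exprMn expr_card_scalar.
Qed.

(** The [q]-th power map permutes the summands of the trace cyclically, and its fixed points are the
    scalars. *)
Lemma trace_pow_scalar x : Tr x \in 1%VS.
Proof.
rewrite Fermat's_little_theorem dimv1; apply/eqP.
have zq : 0 ^+ (#|F| ^ 1) = 0 :> K.
  by rewrite expr0n expn1 -leqn0 leqNgt (ltnW (finNzRing_gt1 F)).
rewrite (big_morph _ (@expr_card_expD F K 1) zq).
have := expr_card_full x; rewrite /trace_pow.
case: n (adim_gt0 {:K}%AS) => // m _ xq.
(* The last summand on the left is [x ^+ (q ^ n) = x], the first one on the right. *)
rewrite big_ord_recr big_ord_recl /= addrC expr1 -exprM -expnD addn1 xq.
by congr (_ + _); apply: eq_bigr => i _; rewrite -exprM -expnD addn1.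
Qed.

(** If [x] were nonzero, [x * y] would run over all of [K], so the nonzero polynomial [Tr('X)], of
    degree at most [q ^ (n - 1)], would be divisible by ['X^(q ^ n) - 'X]. *)
Lemma trace_pow_nondegenerate x : (forall y, Tr (x * y) = 0) -> x = 0.
Proof.
move=> x0; apply/eqP/negP => /negP xN0.
have : 'X^(#|F| ^ n) - 'X %| trace_pow #|F| n ('X : {poly K}).
  apply/dvdp_finite_field => y; rewrite horner_trace_pow hornerX.
  by rewrite -(mulVKf xN0 y) x0.
have q1 := finNzRing_gt1 F.
case: n (adim_gt0 {:K}%AS) => // m _.
move/(dvdp_leq (trace_powX_neq0 K m q1))/leq_trans/(_ (size_trace_powX K m q1)).
have qm : (1 < #|F| ^ m.+1)%N by rewrite -(expn0 #|F|) ltn_exp2l.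
rewrite size_polyDl ?size_polyXn ?size_polyN ?size_polyX // ltnS.
by rewrite leq_exp2l // ltnn.
Qed.

Definition trace_comb_adjoint m (theta omega : m.-tuple K) u :=
  \sum_(i < m) Tr (u * tnth omega i) * tnth theta i.

(** Traces are scalars and leave the outer trace, so both sides are the sum of the products
    [Tr (theta_i x) Tr (u omega_i)]. *)
Lemma trace_comb_adjointP (theta omega : n.-tuple K) u x :
  Tr (u * (trace_comb #|F| theta omega).[x]) =
  Tr (trace_comb_adjoint theta omega u * x).
Proof.
rewrite horner_trace_comb mulr_sumr mulr_suml !trace_pow_sum.
apply: eq_bigr => i _.
by rewrite mulrCA -mulrA !(trace_pow_scalarM _ (trace_pow_scalar _)) mulrC.
Qed.

Lemma trace_comb_adjointB m (theta omega : m.-tuple K) u v :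
  trace_comb_adjoint theta omega (u - v) =
  trace_comb_adjoint theta omega u - trace_comb_adjoint theta omega v.
Proof.
apply/eqP; rewrite eq_sym subr_eq -big_split /=; apply/eqP/eq_bigr => i _.
by rewrite -mulrDl -trace_powD -mulrDl subrK.
Qed.

Lemma trace_combB (theta omega : n.-tuple K) x y :
  (trace_comb #|F| theta omega).[x - y] =
  (trace_comb #|F| theta omega).[x] - (trace_comb #|F| theta omega).[y].
Proof.
rewrite !horner_trace_comb; apply/eqP; rewrite eq_sym subr_eq -big_split /=.
by apply/eqP/eq_bigr => i _; rewrite -mulrDl -trace_powD -mulrDr subrK.
Qed.

End Trace.

Theorem theorem4p1 (q n : nat) (Fq : finFieldType) (K : fieldExtType Fq)
    (hq : #|Fq| = q) (hn : (1 <= n)%N) (hK : \dim {:K} = n)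
    (theta : n.-tuple K) (htheta : basis_of {:K} theta)
    (omega : n.-tuple K) :
  permutation_poly (trace_comb q theta omega) <->
  (forall u : K, u != 0 ->
     ~~ ('X^(q ^ n) - 'X %| trace_pow q n (u%:P * trace_comb q theta omega))).
Proof.
subst q n; split=> [[g _ gK] u uN0 | dvdN].
  apply/negP => /dvdp_finite_field Tr0; move/eqP: uN0; apply.
  apply: trace_pow_nondegenerate => y.
  (* Every [y] is a value of [L], namely at [g y], so [Tr (u y) = 0]. *)
  by rewrite -(gK y) -(Tr0 (g y)) horner_trace_pow hornerM hornerC.
have adj_inj : injective (trace_comb_adjoint theta omega).
  move=> u v uv; apply/eqP; rewrite -subr_eq0; apply: contraT => /dvdN.
  case/dvdp_finite_field => x; rewrite horner_trace_pow hornerM hornerC.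
  rewrite trace_comb_adjointP trace_comb_adjointB uv subrr mul0r.
  exact/trace_pow0/ltnW/finNzRing_gt1.
have [h _ hK] := injF_bij (T := finvect_type K) adj_inj.
apply: (injF_bij (T := finvect_type K)) => x y xy.
apply/eqP; rewrite -subr_eq0; apply/eqP/trace_pow_nondegenerate => z.
(* Writing [z = L' (h z)] moves the adjoint across: [Tr (z (x - y)) = Tr (h z * L(x - y))], where
   [L(x - y) = 0]. *)
rewrite mulrC -(hK z) -trace_comb_adjointP trace_combB xy subrr mulr0.
exact/trace_pow0/ltnW/finNzRing_gt1.
Qed.
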